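(* Let $T_n\subseteq{}^{\omega>}2$ (for $n<\omega$) be trees with no maximal nodes, $\bar{T}=\langle T_n:n<\omega\rangle$, let $2\leq\iota<\omega$ and $k=2\iota$. Let $\mathbf{M}_{\bar{T},k}$, the relation $\sqsubseteq$, the translations $\mathbf{m}+\rho$, the rank ${\rm ndrk}$ and ${\rm NDRK}(\bar{T})$ be as defined in the context. Then: (1) The relation $\sqsubseteq$ is a partial order on $\mathbf{M}_{\bar{T},k}$. (2) If $\mathbf{m},\mathbf{n}\in\mathbf{M}_{\bar{T},k}$, $\mathbf{m}\sqsubseteq\mathbf{n}$ and $\alpha\leq{\rm ndrk}(\mathbf{n})$, then $\alpha\leq{\rm ndrk}(\mathbf{m})$. (3) The function ${\rm ndrk}$ is well defined (that is, if $\beta<\alpha$ and ${\rm ndrk}(\mathbf{m})\geq\alpha$, then ${\rm ndrk}(\mathbf{m})\geq\beta$). (4) If $\mathbf{m}\in\mathbf{M}_{\bar{T},k}$ and $\rho\in{}^{\omega}2$, then ${\rm ndrk}(\mathbf{m})={\rm ndrk}(\mathbf{m}+\rho)$. (5) If $\mathbf{m}\in\mathbf{M}_{\bar{T},k}$, $\nu\in u_{\mathbf{m}}$ and ${\rm ndrk}(\mathbf{m})\geq\omega_1$, then there is $\mathbf{n}\in\mathbf{M}_{\bar{T},k}$ such that $\mathbf{m}\sqsubseteq\mathbf{n}$, ${\rm ndrk}(\mathbf{n})\geq\omega_1$ and $|\{\eta\in u_{\mathbf{n}}:\nu\vartriangleleft\eta\}|\geq 2$. (6) If $\mathbf{m}\in\mathbf{M}_{\bar{T},k}$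 and $\infty>{\rm ndrk}(\mathbf{m})=\beta>\alpha$, then there is $\mathbf{n}\in\mathbf{M}_{\bar{T},k}$ such that $\mathbf{m}\sqsubseteq\mathbf{n}$ and ${\rm ndrk}(\mathbf{n})=\alpha$. (7) If ${\rm NDRK}(\bar{T})\geq\omega_1$, then ${\rm NDRK}(\bar{T})=\infty$. (8) Assume $\mathbf{m}\in\mathbf{M}_{\bar{T},k}$ and $u'\subseteq u_{\mathbf{m}}$, $|u'|\geq 2$. Put $\ell'=\ell_{\mathbf{m}}$, $h'_i=h^{\mathbf{m}}_i\restriction(u')^{\langle2\rangle}$ and $g'_i=g^{\mathbf{m}}_i\restriction(u')^{\langle2\rangle}$ (for $i<\iota$), and let $\mathbf{m}\restriction u'=(\ell',u',\bar{h}',\bar{g}')$ where $\bar h'=\langle h'_i:i<\iota\rangle$ and $\bar g'=\langle g'_i:i<\iota\rangle$. Then $\mathbf{m}\restriction u'\in\mathbf{M}_{\bar{T},k}$ and ${\rm ndrk}(\mathbf{m})\leq{\rm ndrk}(\mathbf{m}\restriction u')$.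
   Context: ${}^{\omega>}2$ is the set of finite 0-1 sequences, ${}^{\ell}2$ those of length $\ell$; $+$ is coordinatewise addition modulo 2; $\nu\vartriangleleft\eta$ means that $\nu$ is a proper initial segment of $\eta$. For a set $u$, $u^{\langle2\rangle}=\{(x,y)\in u\times u:x\neq y\}$. $\mathbf{M}_{\bar{T},k}$ consists of all tuples $\mathbf{m}=(\ell_{\mathbf{m}},u_{\mathbf{m}},\bar{h}_{\mathbf{m}},\bar{g}_{\mathbf{m}})=(\ell,u,\bar{h},\bar{g})$ such that: (a) $0<\ell<\omega$, $u\subseteq{}^{\ell}2$ and $2\leq|u|$; (b) $\bar{h}=\langle h_i:i<\iota\rangle$, $\bar{g}=\langle g_i:i<\iota\rangle$, with $h_i:u^{\langle2\rangle}\to\omega$ and $g_i:u^{\langle2\rangle}\to\bigcup_{n<\omega}(T_n\cap{}^{\ell}2)$ for each $i<\iota$; (c) $g_i(\eta,\nu)\in T_{h_i(\eta,\nu)}\cap{}^{\ell}2$ for all $(\eta,\nu)\in u^{\langle2\rangle}$, $i<\iota$; (d) $\eta+g_i(\eta,\nu)=\nu+g_i(\nu,\eta)$ for all $(\eta,\nu)\in u^{\langle2\rangle}$, $i<\iota$; (e) for any $(\eta,\nu)\in u^{\langle2\rangle}$ there are no repetitions in the sequence $\langle g_i(\eta,\nu),g_i(\nu,\eta):i<\iota\rangle$. The components of $\bar h_{\mathbf m},\bar g_{\mathbf m}$ are written $h^{\mathbf m}_i,g^{\mathbf m}_i$. Translations: for $\mathbf{m}=(\ell,u,\bar{h},\bar{g})\in\mathbf{M}_{\bar{T},k}$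 and $\rho\in{}^{\ell}2$, $\mathbf{m}+\rho=(\ell,u',\bar{h}',\bar{g}')$ where $u'=\{\eta+\rho:\eta\in u\}$, $h'_i(\eta+\rho,\nu+\rho)=h_i(\eta,\nu)$ and $g'_i(\eta+\rho,\nu+\rho)=g_i(\eta,\nu)$ for $(\eta,\nu)\in u^{\langle2\rangle}$, $i<\iota$. For $\rho\in{}^{\omega}2$, $\mathbf{m}+\rho=\mathbf{m}+(\rho\restriction\ell)$. Extension: $\mathbf{m}\sqsubseteq\mathbf{n}$ iff $\ell_{\mathbf{m}}\leq\ell_{\mathbf{n}}$, $u_{\mathbf{m}}=\{\eta\restriction\ell_{\mathbf{m}}:\eta\in u_{\mathbf{n}}\}$, and for every $(\eta,\nu)\in(u_{\mathbf{n}})^{\langle2\rangle}$ with $\eta\restriction\ell_{\mathbf{m}}\neq\nu\restriction\ell_{\mathbf{m}}$ and each $i<\iota$: $h^{\mathbf{m}}_i(\eta\restriction\ell_{\mathbf{m}},\nu\restriction\ell_{\mathbf{m}})=h^{\mathbf{n}}_i(\eta,\nu)$ and $g^{\mathbf{m}}_i(\eta\restriction\ell_{\mathbf{m}},\nu\restriction\ell_{\mathbf{m}})=g^{\mathbf{n}}_i(\eta,\nu)\restriction\ell_{\mathbf{m}}$. Rank ${\rm ndrk}:\mathbf{M}_{\bar{T},k}\to{\rm ON}\cup\{\infty\}$, defined by declaring inductively when ${\rm ndrk}(\mathbf{m})\geq\alpha$: ${\rm ndrk}(\mathbf{m})\geq0$ always; for limit $\alpha$, ${\rm ndrk}(\mathbf{m})\geq\alpha$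 iff ${\rm ndrk}(\mathbf{m})\geq\beta$ for all $\beta<\alpha$; ${\rm ndrk}(\mathbf{m})\geq\beta+1$ iff for every $\nu\in u_{\mathbf{m}}$ there is $\mathbf{n}\in\mathbf{M}_{\bar{T},k}$ with $\ell_{\mathbf{n}}>\ell_{\mathbf{m}}$, $\mathbf{m}\sqsubseteq\mathbf{n}$, ${\rm ndrk}(\mathbf{n})\geq\beta$ and $|\{\eta\in u_{\mathbf{n}}:\nu\vartriangleleft\eta\}|\geq2$; ${\rm ndrk}(\mathbf{m})=\infty$ iff ${\rm ndrk}(\mathbf{m})\geq\alpha$ for all ordinals $\alpha$ (otherwise ${\rm ndrk}(\mathbf m)$ is the largest $\alpha$ with ${\rm ndrk}(\mathbf m)\geq\alpha$). ${\rm NDRK}(\bar{T})=\sup\{{\rm ndrk}(\mathbf{m})+1:\mathbf{m}\in\mathbf{M}_{\bar{T},k}\}$ (with $\infty+1=\infty$). *)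

(* Defs.v *)
From HB Require Import structures.
From mathcomp Require Import all_boot.
From mathcomp Require Import boolp classical_sets functions cardinality.

Set Implicit Arguments.
Unset Strict Implicit.
Unset Printing Implicit Defensive.

Local Open Scope classical_set_scope.
Local Open Scope quotient_scope.

(* Ordinals.  The tree [ONode A f] denotes the ordinal sup {f i + 1 : i in A}; *)
(* the order type of every (small) well-order is denoted by a tree.  [ON] is  *)
(* the quotient by "denotes the same ordinal", so that equality of ordinals    *)
(* is Leibniz equality.                                                        *)

Inductive otree : Type := ONode (A : Type) of A -> otree.

(* sup (f i + 1) <= sup (g j + 1) iff every f i is below some g j *)
Fixpoint otree_le (a b : otree) : Prop :=
  match a, b with
  | ONode A f, ONode B g => forall i, exists j, otree_le (f i) (g j)
  end.

Definition otree_lt (a b : otree) : Prop :=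
  match b with ONode B g => exists j, otree_le a (g j) end.

Lemma otree_le_refl a : otree_le a a.
Proof. by elim: a => A f IH /= i; exists i. Qed.

Lemma otree_le_trans b a c : otree_le a b -> otree_le b c -> otree_le a c.
Proof.
elim: a b c => A f IH [B g] [C l] /= ab bc i.
have [j fg] := ab i; have [k gl] := bc j.
by exists k; apply: IH fg gl.
Qed.

Lemma otree_total a b : otree_lt a b \/ otree_le b a.
Proof.
elim: a b => A f IH [B g].
case: (pselect (otree_lt (ONode f) (ONode g))) => [|H]; first by left.
right => /= j; apply: contrapT => K; apply: H; exists j.
case: (g j) K => C l K /= i.
by have [//|h] := IH i (ONode l); case: K; exists i.
Qed.

Lemma otree_lt_le_trans b a c : otree_lt a b -> otree_le b c -> otree_lt a c.
Proof.
case: b c => B g [C l] [j h] /(_ j)[k h2].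
by exists k; apply: otree_le_trans h h2.
Qed.

Lemma otree_le_lt_trans b a c : otree_le a b -> otree_lt b c -> otree_lt a c.
Proof. by case: c => C l ab [j h]; exists j; apply: otree_le_trans ab h. Qed.

Lemma otree_ltW a b : otree_lt a b -> otree_le a b.
Proof.
elim: a b => A f IH [B g] [j]; case E : (g j) => [C l] h i.
by exists j; rewrite E; apply: IH; exact: h i.
Qed.

Lemma otree_lt_wf : well_founded otree_lt.
Proof.
move=> a; suff H b : otree_le b a -> Acc otree_lt b.
  by apply: H; apply: otree_le_refl.
elim: a b => A f IH b hb; constructor => c hc.
by have [i h] := otree_lt_le_trans hc hb; exact: IH h.
Qed.

Lemma otree_lt_irr a : ~ otree_lt a a.
Proof. by elim: (otree_lt_wf a) => b _ IH k; exact: (IH _ k k). Qed.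

Definition otree_eq (a b : otree) : bool := `[< otree_le a b /\ otree_le b a >].

Lemma otree_eq_refl : reflexive otree_eq.
Proof. by move=> a; apply/asboolP; split; apply: otree_le_refl. Qed.

Lemma otree_eq_sym : symmetric otree_eq.
Proof. by move=> a b; apply/asboolP/asboolP => -[]. Qed.

Lemma otree_eq_trans : transitive otree_eq.
Proof.
move=> b a c /asboolP[ab ba] /asboolP[bc cb]; apply/asboolP.
by split; [apply: otree_le_trans ab bc | apply: otree_le_trans cb ba].
Qed.

HB.instance Definition _ := gen_eqMixin otree.
HB.instance Definition _ := gen_choiceMixin otree.

Canonical otree_eq_equiv :=
  EquivRel otree_eq otree_eq_refl otree_eq_sym otree_eq_trans.

Definition ON : Type := {eq_quot otree_eq}.
HB.instance Definition _ := Choice.on ON.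
HB.instance Definition _ := EqQuotient.on ON.

Definition ord_le (x y : ON) : Prop := otree_le (repr x) (repr y).
Definition ord_lt (x y : ON) : Prop := otree_lt (repr x) (repr y).

Definition ord_zero : ON := \pi_ON (ONode (fun e : False => match e with end)).
Definition ord_succ (x : ON) : ON := \pi_ON (ONode (fun _ : unit => repr x)).
Definition ord_limit (x : ON) : Prop :=
  ord_lt ord_zero x /\ forall y, ord_lt y x -> ord_lt (ord_succ y) x.

Lemma repr_pi_le a :
  otree_le (repr (\pi_ON a)) a /\ otree_le a (repr (\pi_ON a)).
Proof. by case: (piP ON a) => x /eqquotP /asboolP[? ?]; split. Qed.

Lemma ord_le_anti x y : ord_le x y -> ord_le y x -> x = y.
Proof.
by move=> xy yx; rewrite -(reprK x) -(reprK y); apply/eqquotP/asboolP.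
Qed.

Lemma ord_lt_wf : well_founded ord_lt.
Proof.
move=> x; have := otree_lt_wf (repr x); move E : (repr x) => a H.
elim: H x E => {}a _ IH x E; constructor => y; rewrite /ord_lt E => h.
exact: (IH _ h _ erefl).
Qed.

Lemma ord_lt_pi x a : ord_lt x (\pi_ON a) <-> otree_lt (repr x) a.
Proof. by have [h1 h2] := repr_pi_le a; split=> h; apply: otree_lt_le_trans h _. Qed.

Lemma ord_lt_succ x y : ord_lt y (ord_succ x) <-> ord_le y x.
Proof. by rewrite ord_lt_pi /=; split; [case | move=> h; exists tt]. Qed.

Lemma ord_zero_le x : ord_le ord_zero x.
Proof.
apply: otree_le_trans (repr_pi_le _).1 _.
by case: (repr x) => B g; case.
Qed.

Lemma ord_trichotomy x :
  x = ord_zero \/ (exists y, x = ord_succ y) \/ ord_limit x.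
Proof.
have [h|h] := otree_total (repr ord_zero) (repr x); last first.
  by left; apply: ord_le_anti => //; exact: ord_zero_le.
right; case: (pselect (exists y, x = ord_succ y)) => [|H]; first by left.
right; split => // y yx.
have [//|k] := otree_total (repr (ord_succ y)) (repr x).
case: H; exists y; apply: ord_le_anti => //.
apply: otree_le_trans (repr_pi_le _).1 _.
by move: yx; rewrite /ord_lt; case: (repr x) => B g [j hj] _; exists j.
Qed.

HB.instance Definition _ := isPointed.Build ON ord_zero.

Definition omega1 : ON :=
  get [set x : ON | ~ countable [set y | ord_lt y x] /\
                    forall y, ord_lt y x -> countable [set z | ord_lt z y]].

(* Every countable ordinal is the rank of an element of a well-founded        *)
(* relation on nat; [wf_rank_sup] is the supremum of these ranks plus one,    *)
(* i.e. omega1.  It only serves to show that [omega1] is not a junk value.    *)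
Fixpoint wf_rank (R : nat -> nat -> Prop) n (h : Acc R n) {struct h} : otree :=
  ONode (fun k : {k | R k n} => wf_rank (Acc_inv h (svalP k))).

Definition wf_rank_sup : otree :=
  ONode (fun R : {R : nat -> nat -> Prop | well_founded R} =>
    ONode (fun n : nat => wf_rank (svalP R n))).

Lemma countable_lt_wf_rank_sup (x : ON) :
  countable [set y | ord_lt y x] -> otree_lt (repr x) wf_rank_sup.
Proof.
case/countable_injP => f fi.
pose R m n := exists y z, [/\ ord_lt y z, ord_lt z x, f y = m & f z = n].
have wR : well_founded R.
  move=> n; constructor => m [y [z [yz zx <- _]]].
  have yx : ord_lt y x by apply: otree_lt_le_trans yz (otree_ltW zx).
  elim: (ord_lt_wf y) yx => {m yz} {}y _ IH yx.
  constructor => m [y' [z' [yz' zx' <- e]]].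
  have ? : z' = y by apply: fi; rewrite ?inE.
  subst z'; apply: IH => //.
  by apply: otree_lt_le_trans yz' (otree_ltW yx).
exists (exist _ R wR) => /=.
have key y (h : Acc R (f y)) : ord_lt y x -> otree_le (repr y) (wf_rank h).
  elim: (ord_lt_wf y) h => {}y _ IH h yx.
  case: (otree_total (wf_rank h) (repr y)) => //; case: h => h.
  rewrite {1}/wf_rank -/wf_rank => hlt.
  pose z := \pi_ON (wf_rank (Acc_intro _ h)).
  have zy : ord_lt z y by apply: otree_le_lt_trans (repr_pi_le _).1 _.
  have zx : ord_lt z x by apply: otree_lt_le_trans zy (otree_ltW yx).
  have Rz : R (f z) (f y) by exists z, y.
  have hh := IH z zy (h _ Rz) zx.
  exfalso; apply: (@otree_lt_irr (wf_rank (Acc_intro _ h))).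
  pose k : {k | R k (f y)} := exist (fun k => R k (f y)) _ Rz.
  exists k.
  have -> : Acc_inv (Acc_intro (f y) h) (svalP k) = h _ Rz.
    exact: Prop_irrelevance.
  exact: (otree_le_trans (repr_pi_le (wf_rank (Acc_intro (f y) h))).2 hh).
case E : (repr x) => [B g] j.
have yx : ord_lt (\pi_ON (g j)) x.
  by rewrite /ord_lt E; exists j; exact: (repr_pi_le _).1.
exists (f (\pi_ON (g j))); apply: otree_le_trans (repr_pi_le _).2 _.
exact: key.
Qed.

Lemma lt_wf_rank_sup_countable a :
  otree_lt a wf_rank_sup -> countable [set y | ord_lt y (\pi_ON a)].
Proof.
case=> -[R wR] /= h.
have H y : exists n, ord_lt y (\pi_ON a) ->
    otree_le (repr y) (wf_rank (wR n)) /\ otree_le (wf_rank (wR n)) (repr y).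
  case: (pselect (ord_lt y (\pi_ON a))) => [/ord_lt_pi ya|]; last by exists 0.
  have [n] : exists n, otree_le (repr y) (wf_rank (wR n)).
    have [n hn] := otree_lt_le_trans ya h; exists n.
    by rewrite (Prop_irrelevance (wR n) (svalP (exist _ R wR) n)).
  elim: (wR n) (wR n) => {}n _ IH An hn.
  case: (otree_total (repr y) (wf_rank An)) => [hlt|]; last first.
    by exists n; rewrite (Prop_irrelevance (wR n) An).
  by case: An hn hlt => An hn [[k Rk] hk]; exact: (IH k Rk _ hk).
have [F hF] := choice H.
apply/countable_injP; exists F => y z.
rewrite !inE => /hF[a1 a2] /hF[b1 b2] E; apply: ord_le_anti.
  by apply: otree_le_trans a1 _; rewrite E.
by apply: otree_le_trans b1 _; rewrite -E.
Qed.

Lemma omega1P :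
  ~ countable [set y | ord_lt y omega1] /\
  forall y, ord_lt y omega1 -> countable [set z | ord_lt z y].
Proof.
apply: (getPex (P := [set x : ON | ~ countable [set y | ord_lt y x] /\
          forall y, ord_lt y x -> countable [set z | ord_lt z y]])).
exists (\pi_ON wf_rank_sup); split=> /=.
  move/countable_lt_wf_rank_sup => h; apply: (@otree_lt_irr wf_rank_sup).
  exact: (otree_le_lt_trans (repr_pi_le wf_rank_sup).2 h).
by move=> y /ord_lt_pi /lt_wf_rank_sup_countable; rewrite reprK.
Qed.

Variant ONoo : Type := Fin of ON | Infty.

HB.instance Definition _ := gen_eqMixin ONoo.
HB.instance Definition _ := gen_choiceMixin ONoo.
HB.instance Definition _ := isPointed.Build ONoo Infty.

Definition oo_le (x y : ONoo) : Prop :=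
  match x, y with
  | _, Infty => True
  | Infty, Fin _ => False
  | Fin a, Fin b => ord_le a b
  end.

Definition oo_succ (x : ONoo) : ONoo :=
  if x is Fin a then Fin (ord_succ a) else Infty.

Definition oo_sup (A : set ONoo) : ONoo :=
  get [set x | (forall y, A y -> oo_le y x) /\
               forall z, (forall y, A y -> oo_le y z) -> oo_le x z].

Definition proper_prefix (s t : seq bool) : bool :=
  prefix s t && (size s < size t).

Definition is_tree (S : set (seq bool)) : Prop :=
  forall s t, prefix s t -> S t -> S s.

Definition no_maximal_nodes (S : set (seq bool)) : Prop :=
  forall s, S s -> exists2 t, S t & proper_prefix s t.

Definition btadd (l : nat) (x y : l.-tuple bool) : l.-tuple bool :=
  [tuple tnth x i (+) tnth y i | i < l].

Definition btrestr (rho : nat -> bool) (l : nat) : l.-tuple bool :=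
  [tuple rho i | i < l].

Lemma btaddK l (r : l.-tuple bool) : involutive (fun x => btadd x r).
Proof. by move=> x; apply: eq_from_tnth => i; rewrite !tnth_mktuple addbK. Qed.

(* u^<2> as a finite type *)
Definition offdiag (T : finType) (u : {set T}) :=
  {p : T * T | [&& p.1 \in u, p.2 \in u & p.1 != p.2]}.

Lemma offdiag_swap_subproof (T : finType) (u : {set T}) (p : offdiag u) :
  [&& (val p).2 \in u, (val p).1 \in u & (val p).2 != (val p).1].
Proof. by case: p => -[x y] /= /and3P[-> ->]; rewrite eq_sym => ->. Qed.

Definition offdiag_swap (T : finType) (u : {set T}) (p : offdiag u) :
  offdiag u := exist _ ((val p).2, (val p).1) (offdiag_swap_subproof p).

(* Raw tuples (l, u, h, g): conditions on the values are imposed by [inM]. *)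
Record mtuple (iota : nat) := MTuple {
  ell : nat;
  um : {set ell.-tuple bool};
  hm : {ffun 'I_iota -> {ffun offdiag um -> nat}};
  gm : {ffun 'I_iota -> {ffun offdiag um -> ell.-tuple bool}}
}.

(* Membership in M_{T,k}, for k = 2 * iota. *)
Definition inM (T : nat -> set (seq bool)) (iota : nat) (m : mtuple iota) :
    Prop :=
  [/\ 0 < ell m /\ 2 <= #|um m|,
      forall (i : 'I_iota) (p : offdiag (um m)), T (hm m i p) (gm m i p),
      forall (i : 'I_iota) (p : offdiag (um m)),
        btadd (val p).1 (gm m i p) =
        btadd (val p).2 (gm m i (offdiag_swap p)) &
      forall p : offdiag (um m),
        uniq (flatten [seq [:: gm m i p; gm m i (offdiag_swap p)]
                      | i : 'I_iota])].

Lemma translate_subproof (l : nat) (u : {set l.-tuple bool})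
    (r : l.-tuple bool) (p : offdiag [set btadd x r | x in u]%SET) :
  [&& btadd (val p).1 r \in u, btadd (val p).2 r \in u &
      btadd (val p).1 r != btadd (val p).2 r].
Proof.
case: p => -[x y] /= /and3P[/imsetP[a au ->] /imsetP[b bu ->]].
by rewrite !btaddK au bu; apply: contraNneq => ->.
Qed.

Definition untranslate (l : nat) (u : {set l.-tuple bool}) (r : l.-tuple bool)
    (p : offdiag [set btadd x r | x in u]%SET) : offdiag u :=
  exist _ (btadd (val p).1 r, btadd (val p).2 r) (translate_subproof p).

(* Since r + r = 0, the value at (x + r, y + r) is the old value at (x, y). *)
Definition translate (iota : nat) (m : mtuple iota)
    (r : (ell m).-tuple bool) : mtuple iota :=
  @MTuple iota (ell m) [set btadd x r | x in um m]%SET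
    [ffun i => [ffun p => hm m i (untranslate p)]]
    [ffun i => [ffun p => gm m i (untranslate p)]].
Arguments translate {iota} m r.

Lemma restrict_subproof (T : finType) (u u' : {set T}) (s : u' \subset u)
    (p : offdiag u') :
  [&& (val p).1 \in u, (val p).2 \in u & (val p).1 != (val p).2].
Proof. by case: p => -[x y] /= /and3P[/(fintype.subsetP s)-> /(fintype.subsetP s)->]. Qed.

Definition offdiag_incl (T : finType) (u u' : {set T}) (s : u' \subset u)
    (p : offdiag u') : offdiag u := exist _ (val p) (restrict_subproof s p).

Definition restrict (iota : nat) (m : mtuple iota)
    (u' : {set (ell m).-tuple bool}) (s : u' \subset um m) : mtuple iota :=
  @MTuple iota (ell m) u'
    [ffun i => [ffun p => hm m i (offdiag_incl s p)]]
    [ffun i => [ffun p => gm m i (offdiag_incl s p)]].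
Arguments restrict {iota} m {u'} s.

(* The pair [q] plays the role of the pair of restrictions of [p]; it exists  *)
(* exactly when these restrictions are distinct.                              *)
Definition extends (iota : nat) (m n : mtuple iota) : Prop :=
  [/\ ell m <= ell n,
      [set tval x | x in [set` um m]] =
        [set take (ell m) (tval y) | y in [set` um n]] &
      forall (p : offdiag (um n)) (q : offdiag (um m)),
        take (ell m) (val p).1 = (val q).1 ->
        take (ell m) (val p).2 = (val q).2 ->
        forall i : 'I_iota,
          hm m i q = hm n i p /\
          (gm m i q : seq bool) = take (ell m) (gm n i p)].

Definition splits_at (iota : nat) (n : mtuple iota) (s : seq bool) : Prop :=
  2 <= #|[set y in um n | proper_prefix s y]%SET|.

(* [ndrk_ge T m a] is the inductively declared relation "ndrk(m) >= a". *)
Inductive ndrk_ge (T : nat -> set (seq bool)) (iota : nat) :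
    mtuple iota -> ON -> Prop :=
| ndrk_ge_zero m : ndrk_ge T m ord_zero
| ndrk_ge_limit m a :
    ord_limit a -> (forall b, ord_lt b a -> ndrk_ge T m b) -> ndrk_ge T m a
| ndrk_ge_succ m b :
    (forall x, x \in um m ->
       exists n, [/\ inM T n, ell m < ell n, extends m n, ndrk_ge T n b &
                     splits_at n x]) ->
    ndrk_ge T m (ord_succ b).

Definition ndrk (T : nat -> set (seq bool)) (iota : nat) (m : mtuple iota) :
    ONoo :=
  if `[< forall a, ndrk_ge T m a >] then Infty
  else Fin (get [set a | ndrk_ge T m a /\
                         forall b, ndrk_ge T m b -> ord_le b a]).

Definition NDRK (T : nat -> set (seq bool)) (iota : nat) : ONoo :=
  oo_sup [set oo_succ (ndrk T m) | m in [set m : mtuple iota | inM T m]].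

(* Main.v *)
From HB Require Import structures.
Require Import Defs.
From mathcomp Require Import all_boot.
From mathcomp Require Import boolp classical_sets cardinality.

(** Everything rests on monotonicity of [ndrk_ge] along extensions: if [n]
extends [m], a split of [n] above [y] is also a split above the restriction of
[y], so [m] inherits every bound on the rank of [n].  Translating or
restricting a witness of a successor step for [m] gives a witness for the
translate or restriction of [m].  There are only countably many tuples, so
witnesses of rank at least each countable ordinal can be replaced by a single
witness of rank at least omega1; iterating, rank at least omega1 already means
infinite rank. *)

Set Implicit Arguments.
Unset Strict Implicit.
Unset Printing Implicit Defensive.

Local Open Scope classical_set_scope.

(** * Ordinals *)

Lemma ord_lt_irr x : ~ ord_lt x x.
Proof. exact: otree_lt_irr. Qed.

Lemma ord_ltW x y : ord_lt x y -> ord_le x y.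
Proof. exact: otree_ltW. Qed.

Lemma ord_le_refl x : ord_le x x.
Proof. exact: otree_le_refl. Qed.

Lemma ord_lt_succ_diag x : ord_lt x (ord_succ x).
Proof. by apply/ord_lt_succ; apply: ord_le_refl. Qed.

Lemma ord_lt_or_ge x y : ord_lt x y \/ ord_le y x.
Proof. exact: otree_total. Qed.

Lemma ord_le_lt_trans y x z : ord_le x y -> ord_lt y z -> ord_lt x z.
Proof. exact: otree_le_lt_trans. Qed.

Lemma ord_lt_le_trans y x z : ord_lt x y -> ord_le y z -> ord_lt x z.
Proof. exact: otree_lt_le_trans. Qed.

Lemma ord_le_eqVlt x y : ord_le x y -> x = y \/ ord_lt x y.
Proof.
move=> xy; have [|yx] := ord_lt_or_ge x y; [by right | left].
exact: ord_le_anti.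
Qed.

Lemma ord_succ_le x y : ord_lt x y -> ord_le (ord_succ x) y.
Proof.
move=> xy; have [/ord_lt_succ yx|//] := ord_lt_or_ge y (ord_succ x).
by case: (@ord_lt_irr x); apply: ord_lt_le_trans xy yx.
Qed.

Lemma ord_succ_inj : injective ord_succ.
Proof.
move=> x y E; apply: ord_le_anti; apply/ord_lt_succ.
  by rewrite -E; apply: ord_lt_succ_diag.
by rewrite E; apply: ord_lt_succ_diag.
Qed.

Lemma ord_zero_neq_succ x : ord_zero <> ord_succ x.
Proof.
move=> E; apply: (@ord_lt_irr x).
by apply: ord_lt_le_trans (ord_zero_le x); rewrite E; apply: ord_lt_succ_diag.
Qed.

Lemma ord_limit_neq_succ x : ~ ord_limit (ord_succ x).
Proof.
by case=> _ /(_ _ (ord_lt_succ_diag x)); apply: ord_lt_irr.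
Qed.

(** Transfinite induction split along the three clauses of [ndrk_ge]; every induction on ranks below
    uses this form. *)
Lemma ord_limit_ind (P : ON -> Prop) :
    P ord_zero -> (forall a, P a -> P (ord_succ a)) ->
    (forall a, ord_limit a -> (forall b, ord_lt b a -> P b) -> P a) ->
  forall a, P a.
Proof.
move=> P0 PS Plim a; elim: (ord_lt_wf a) => {}a _ IH.
have [->//|[[b E]|la]] := ord_trichotomy a; last exact: Plim.
by rewrite E; apply: PS; apply: IH; rewrite E; apply: ord_lt_succ_diag.
Qed.

Lemma ord_least (P : ON -> Prop) a :
  P a -> exists2 b, P b & forall c, P c -> ord_le b c.
Proof.
elim: (ord_lt_wf a) => {}a _ IH Pa.
have [[c Pc ca]|H] := pselect (exists2 c, P c & ord_lt c a).
  exact: IH ca Pc.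
exists a => // c Pc; have [ca|//] := ord_lt_or_ge c a.
by case: H; exists c.
Qed.

(** Otherwise the ordinals below [omega1] would form either the empty set or the countable set of
    ordinals below some [y] with [y] added, hence a countable set. *)
Lemma omega1_limit : ord_limit omega1.
Proof.
have [unc cnt] := omega1P.
have [E|[[y E]|//]] := ord_trichotomy omega1; exfalso; apply: unc.
  have -> : [set y | ord_lt y omega1] = set0; last exact: countable0.
  apply/seteqP; split => // y /= yw; apply: (@ord_lt_irr y).
  by apply: ord_lt_le_trans yw _; rewrite E; apply: ord_zero_le.
have -> : [set z | ord_lt z omega1] = [set z | ord_lt z y] `|` [set y].
  apply/seteqP; rewrite E; split=> z /=.
    by move/ord_lt_succ/ord_le_eqVlt => [->|?]; [right | left].
  by case=> [/ord_ltW|->]; [move/ord_lt_succ | exact: ord_lt_succ_diag].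
rewrite -bigcup2E; apply: bigcup_countable; first exact: countableP.
case=> [|[|i]] _; [|exact: countable1|exact: countable0].
by apply: cnt; rewrite E; apply: ord_lt_succ_diag.
Qed.

(** Regularity of [omega1]: if no [a] below [omega1] were a strict bound, the ordinals below
    [omega1] would be covered by the countably many countable sets of ordinals below the
    [ord_succ (F i)]. *)
Lemma omega1_bounded (I : countType) (P : set I) (F : I -> ON) :
    (forall i, P i -> ord_lt (F i) omega1) ->
  exists2 a, ord_lt a omega1 & forall i, P i -> ord_lt (F i) a.
Proof.
move=> FP; have [unc cnt] := omega1P; apply: contrapT => H; apply: unc.
apply: (@sub_countable _ _ _
  (\bigcup_(i in P) [set z | ord_lt z (ord_succ (F i))])).
  apply: subset_card_le => a /= aw; apply: contrapT => K; apply: H.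
  exists a => // i Pi; have [//|/ord_lt_succ h] := ord_lt_or_ge (F i) a.
  by case: K; exists i.
apply: bigcup_countable => [|i Pi]; first exact: countableP.
by apply: cnt; apply: (omega1_limit.2); apply: FP.
Qed.

(** * The extension order *)

(** The nested dependent pairs carry a countable structure, which transfers to [mtuple iota]; this
    is what makes [omega1_bounded] applicable to families of tuples. *)
Definition mtuple_encode iota (m : mtuple iota) :
    {l : nat & {u : {set l.-tuple bool} &
      ({ffun 'I_iota -> {ffun offdiag u -> nat}} *
       {ffun 'I_iota -> {ffun offdiag u -> l.-tuple bool}})%type}} :=
  existT _ (ell m) (existT _ (um m) (hm m, gm m)).

Definition mtuple_decode iota
    (c : {l : nat & {u : {set l.-tuple bool} &
      ({ffun 'I_iota -> {ffun offdiag u -> nat}} *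
       {ffun 'I_iota -> {ffun offdiag u -> l.-tuple bool}})%type}}) :=
  let: existT _ (existT _ (h, g)) := c in MTuple h g.

Lemma mtuple_encodeK iota :
  cancel (@mtuple_encode iota) (@mtuple_decode iota).
Proof. by case. Qed.

HB.instance Definition _ iota :=
  Countable.copy (mtuple iota) (can_type (@mtuple_encodeK iota)).

Lemma extends_umP iota (m n : mtuple iota) :
  [set tval x | x in [set` um m]] =
    [set take (ell m) (tval y) | y in [set` um n]] <->
  (forall x, x \in um m -> exists2 y, y \in um n & take (ell m) y = x) /\
  (forall y, y \in um n -> exists2 x, x \in um m & take (ell m) y = x).
Proof.
split=> [E|[H K]].
  split=> [x xm|y yn].
    have : [set tval x | x in [set` um m]] (tval x) by exists x.
    by rewrite E => -[y yn <-]; exists y.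
  have : [set take (ell m) (tval y) | y in [set` um n]] (take (ell m) y).
    by exists y.
  by rewrite -E => -[x xm <-]; exists x.
apply/seteqP; split=> s /= [x xm <-].
  by have [y yn yE] := H x xm; exists y.
by have [y yn yE] := K x xm; exists y.
Qed.

Lemma extends_lift iota (m n : mtuple iota) x : extends m n -> x \in um m ->
  exists2 y, y \in um n & take (ell m) y = x.
Proof. by case=> _ /extends_umP[+ _] _; apply. Qed.

Lemma extends_take iota (m n : mtuple iota) y : extends m n -> y \in um n ->
  exists2 x, x \in um m & take (ell m) y = x.
Proof. by case=> _ /extends_umP[_ +] _; apply. Qed.

Lemma offdiag1 (U : finType) (u : {set U}) (p : offdiag u) : (val p).1 \in u.
Proof. by case: p => -[x y] /= /and3P[]. Qed.

Lemma offdiag2 (U : finType) (u : {set U}) (p : offdiag u) : (val p).2 \in u.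
Proof. by case: p => -[x y] /= /and3P[]. Qed.

Lemma offdiag_neq (U : finType) (u : {set U}) (p : offdiag u) :
  (val p).1 != (val p).2.
Proof. by case: p => -[x y] /= /and3P[]. Qed.

Lemma extends_refl iota (m : mtuple iota) : extends m m.
Proof.
have tk (x : (ell m).-tuple bool) : take (ell m) x = x.
  by rewrite take_oversize ?size_tuple.
split=> //; first by apply/extends_umP; split=> x xm; exists x; rewrite ?tk.
move=> p q; rewrite !tk => E1 E2 i.
have -> : q = p.
  by apply: val_inj; apply: injective_projections; apply: val_inj.
by rewrite tk.
Qed.

Lemma extends_anti iota (m n : mtuple iota) :
  extends m n -> extends n m -> m = n.
Proof.
case: m n => [l u h g] [l' u' h' g'] [/= ll' e1 hg] [/= l'l _ _].
have E : l = l' by apply/eqP; rewrite eqn_leq ll' l'l.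
(* The type of [u'] depends on the length, and those of [h'] and [g'] on the carrier, so the
   equalities are substituted in this order before the next components can be compared. *)
case: _ / E u' h' g' e1 hg {ll' l'l} => u' h' g' e1 hg.
have tk (x : l.-tuple bool) : take l x = x.
  by rewrite take_oversize ?size_tuple.
have E : u = u'.
  have /extends_umP[/= H K] :
    [set tval x | x in [set` um (MTuple h g)]] =
    [set take l (tval y) | y in [set` um (MTuple h' g')]] by exact: e1.
  apply/setP => x; apply/idP/idP => [/H[y yu]|/K[y yu]]; rewrite tk.
    by move/val_inj <-.
  by move/val_inj ->.
case: _ / E h' g' hg {e1} => h' g' hg.
have /all_and2[hE gE] i : h i = h' i /\ g i = g' i.
  split; apply/ffunP => p; have [] := hg p p (tk _) (tk _) i => //.
  by rewrite tk => _ /val_inj.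
by congr MTuple; apply/ffunP.
Qed.

Lemma extends_trans iota (n m p : mtuple iota) :
  extends m n -> extends n p -> extends m p.
Proof.
move=> mn np; have [lmn _ hgmn] := mn; have [lnp _ hgnp] := np.
split; first exact: leq_trans lnp.
  apply/extends_umP; split=> [x xm|z zp].
    have [y yn <-] := extends_lift mn xm; have [z zp <-] := extends_lift np yn.
    by exists z; rewrite ?take_takel.
  have [y yn zy] := extends_take np zp; have [x xm yx] := extends_take mn yn.
  by exists x; rewrite // -yx -zy take_takel.
move=> r q r1 r2 i.
(* The conditions on [h] and [g] are chained through the pair of restrictions of [r] to [ell n].
   These are distinct because their further restrictions to [ell m] are the distinct components of
   [q]. *)
have [y1 yn1 E1] := extends_take np (offdiag1 r).
have [y2 yn2 E2] := extends_take np (offdiag2 r).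
have F1 : take (ell m) y1 = (val q).1 by rewrite -E1 take_takel.
have F2 : take (ell m) y2 = (val q).2 by rewrite -E2 take_takel.
have y12 : y1 != y2.
  apply: contraNneq (offdiag_neq q) => y12; apply/eqP/val_inj.
  by rewrite /= -F1 -F2 y12.
have yP : [&& y1 \in um n, y2 \in um n & y1 != y2] by rewrite yn1 yn2.
pose y : offdiag (um n) := exist _ (y1, y2) yP.
have [-> ->] := hgmn y q F1 F2 i; have [-> ->] := hgnp r y E1 E2 i.
by rewrite take_takel.
Qed.

Lemma splits_at_prefix iota (n : mtuple iota) s t :
  prefix s t -> splits_at n t -> splits_at n s.
Proof.
move=> st /leq_trans; apply; apply: subset_leq_card; apply/fintype.subsetP => y.
rewrite !inE => /andP[-> /andP[ty sty]]; rewrite /proper_prefix.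
by rewrite (prefix_trans st ty) (leq_ltn_trans (size_prefix st) sty).
Qed.

(** Some element of [um n] properly extends [s]. This recovers the strict growth of length demanded
    by a successor step when only splitting is known. *)
Lemma splits_at_ell iota (n : mtuple iota) s : splits_at n s -> size s < ell n.
Proof.
move=> h; have /card_gt0P[y] : 0 < #|[set y in um n | proper_prefix s y]%SET|.
  exact: leq_trans h.
by rewrite inE => /andP[_ /andP[_]]; rewrite size_tuple.
Qed.

(** * The rank *)

(** Inversion: a successor is neither zero nor a limit, so only the successor clause can have
    produced the bound. *)
Lemma ndrk_ge_succP T iota (m : mtuple iota) b :
  ndrk_ge T m (ord_succ b) <->
  forall x, x \in um m ->
    exists n, [/\ inM T n, ell m < ell n, extends m n, ndrk_ge T n b &
                  splits_at n x].
Proof.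
split; last exact: ndrk_ge_succ.
move E : (ord_succ b) => a H.
case: H E => [m' /esym/ord_zero_neq_succ//|m' a' + _ E|m' b' + /ord_succ_inj ->//].
by rewrite -E => /ord_limit_neq_succ.
Qed.

Lemma ndrk_ge_limitP T iota (m : mtuple iota) a : ord_limit a ->
  ndrk_ge T m a <-> forall b, ord_lt b a -> ndrk_ge T m b.
Proof.
move=> la; split; last exact: ndrk_ge_limit.
move=> H; case: H la => [? [/ord_lt_irr]|//|? ? _ /ord_limit_neq_succ] //.
Qed.

Lemma ndrk_ge_extends T iota (m n : mtuple iota) a :
  extends m n -> ndrk_ge T n a -> ndrk_ge T m a.
Proof.
move=> mn; elim/ord_limit_ind: a => [|b _|a la IH] ge_a.
- exact: ndrk_ge_zero.
- apply/ndrk_ge_succP => x xm; have [y yn yx] := extends_lift mn xm.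
  (* The witness for [n] at a lift [y] of [x] also serves [m] at [x], since [x] is an initial
     segment of [y]. *)
  have /ndrk_ge_succP/(_ y yn)[n' [Mn' ln' nn' geb sp]] := ge_a.
  exists n'; split=> //; last first.
  + by apply: splits_at_prefix sp; rewrite -yx prefix_take.
  + exact: extends_trans nn'.
  by apply: leq_ltn_trans ln'; case: mn.
- apply/(ndrk_ge_limitP _ _ la) => b ba; apply: IH => //.
  exact: (ndrk_ge_limitP _ _ la).1 ge_a _ ba.
Qed.

Lemma ndrk_ge_ltW T iota (m : mtuple iota) a b :
  inM T m -> ord_lt b a -> ndrk_ge T m a -> ndrk_ge T m b.
Proof.
move=> [[_ um2] _ _ _]; elim/ord_limit_ind: a b => [|a IH|a la _] b ba ge_a.
- by case: (@ord_lt_irr b); apply: ord_lt_le_trans ba (ord_zero_le b).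
(* Any node of [um m] supplies a witness [n] of rank at least [a], and monotonicity along [extends]
   brings this bound back to [m]. *)
- have /card_gt0P[x xm] : 0 < #|um m| by apply: leq_trans um2.
  have /ndrk_ge_succP/(_ x xm)[n [_ _ mn nge _]] := ge_a.
  have {}nge := ndrk_ge_extends mn nge.
  by have [->//|ba'] := ord_le_eqVlt ((ord_lt_succ _ _).1 ba); apply: IH.
- exact: (ndrk_ge_limitP _ _ la).1 ge_a _ ba.
Qed.

Lemma ndrk_ge_leW T iota (m : mtuple iota) a b :
  inM T m -> ord_le b a -> ndrk_ge T m a -> ndrk_ge T m b.
Proof.
by move=> Mm /ord_le_eqVlt[->//|]; apply: ndrk_ge_ltW.
Qed.

(** The least ordinal that fails to bound the rank from below is neither zero nor a limit, so it is
    a successor, and its predecessor is the maximum sought. *)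
Lemma ndrk_ge_max T iota (m : mtuple iota) : inM T m ->
    ~ (forall a, ndrk_ge T m a) ->
  exists a, ndrk_ge T m a /\ forall b, ndrk_ge T m b -> ord_le b a.
Proof.
move=> Mm /existsNP[a0 /(@ord_least (fun a => ~ ndrk_ge T m a))[a nge least_a]].
have [E|[[b E]|la]] := ord_trichotomy a.
- by case: nge; rewrite E; apply: ndrk_ge_zero.
- exists b; split=> [|c gec].
    apply: contrapT => /least_a; rewrite E => h.
    by apply: (@ord_lt_irr b); apply: ord_lt_le_trans h; apply: ord_lt_succ_diag.
  apply/ord_lt_succ; rewrite -E; have [//|ac] := ord_lt_or_ge c a.
  by case: nge; apply: ndrk_ge_leW gec.
- case: nge; apply: ndrk_ge_limit => // b ba; apply: contrapT => /least_a ab.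
  by apply: (@ord_lt_irr b); apply: ord_lt_le_trans ab.
Qed.

(** Links the value [ndrk] to the relation [ndrk_ge]: by [ndrk_ge_max], the [get] in [ndrk] picks a
    true maximum rather than a default value. *)
Lemma ndrkP T iota (m : mtuple iota) a : inM T m ->
  oo_le (Fin a) (ndrk T m) <-> ndrk_ge T m a.
Proof.
move=> Mm; rewrite /ndrk; case: asboolP => [H|/(ndrk_ge_max Mm)/getPex].
  by split.
set b := get _ => -[geb maxb]; split=> [ab|]; last exact: maxb.
exact: ndrk_ge_leW geb.
Qed.

Lemma ndrk_Infty T iota (m : mtuple iota) : inM T m ->
  ndrk T m = Infty <-> forall a, ndrk_ge T m a.
Proof.
move=> Mm; split=> [E a|H]; first by apply/ndrkP => //; rewrite E.
by rewrite /ndrk; case: asboolP.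
Qed.

Lemma ndrk_Fin T iota (m : mtuple iota) a : inM T m ->
  ndrk T m = Fin a <-> ndrk_ge T m a /\ ~ ndrk_ge T m (ord_succ a).
Proof.
move=> Mm; rewrite -!ndrkP //; case: (ndrk T m) => [c|]; last first.
  by split=> // -[].
split=> [[->]|[/= ac sac]].
  split; first exact: ord_le_refl.
  by move/(ord_lt_le_trans (ord_lt_succ_diag a))/ord_lt_irr.
by congr Fin; apply: ord_le_anti => //; have [/ord_succ_le|] := ord_lt_or_ge a c.
Qed.

Lemma oo_leP x y :
  (forall a, oo_le (Fin a) x -> oo_le (Fin a) y) -> oo_le x y.
Proof.
case: x y => [a|] [b|] //= H; first by apply: H; apply: ord_le_refl.
(* Here [x] is [Infty] and [y] is [Fin b]; the lower bound [ord_succ b] of [x] gives the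
   contradiction. *)
apply: (@ord_lt_irr b); apply: ord_lt_le_trans (ord_lt_succ_diag b) _.
exact: H.
Qed.

(* If rank [a] is omitted, rank >= a propagates to rank >= a + 1, and hence
   to every ordinal, along all extensions of [m]. *)
Lemma ndrk_attains T iota (m : mtuple iota) a b : inM T m ->
    ndrk T m = Fin b -> ord_lt a b ->
  exists n, [/\ inM T n, extends m n & ndrk T n = Fin a].
Proof.
move=> Mm /(ndrk_Fin _ Mm)[geb gtb] ab; apply: contrapT => H; apply: gtb.
have up n : inM T n -> extends m n -> ndrk_ge T n a -> ndrk_ge T n (ord_succ a).
  move=> Mn mn gea; apply: contrapT => gta; apply: H.
  by exists n; split=> //; apply/ndrk_Fin.
(* The claim ranges over all extensions [n] because its successor case passes to a witness [n'],
   which [up] provides with rank again at least [a]. *)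
suff all_ge c : forall n, inM T n -> extends m n -> ndrk_ge T n a -> ndrk_ge T n c.
  by apply: all_ge (extends_refl _) (ndrk_ge_ltW Mm ab geb).
elim/ord_limit_ind: c => [|c IH|c lc IH] n Mn mn gea.
- exact: ndrk_ge_zero.
- apply/ndrk_ge_succP => x xn.
  have /ndrk_ge_succP/(_ x xn)[n' [Mn' ln nn' gea' sp]] := up n Mn mn gea.
  exists n'; split=> //.
  by apply: IH => //; apply: extends_trans nn'.
- by apply: ndrk_ge_limit => // d dc; apply: IH.
Qed.

(** * Ranks at least omega1 and countability of the set of tuples *)

Lemma ndrk_ge_omega1_lt T iota (m : mtuple iota) :
  ~ ndrk_ge T m omega1 -> exists2 a, ord_lt a omega1 & ~ ndrk_ge T m a.
Proof.
move=> H; apply: contrapT => K; apply: H; apply: ndrk_ge_limit => [|a aw].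
  exact: omega1_limit.
by apply: contrapT => na; apply: K; exists a.
Qed.

(* There are only countably many candidates for [n], so one of them serves
   cofinally many ordinals below omega1. *)
Lemma ndrk_ge_omega1_splits T iota (m : mtuple iota) x : inM T m ->
    x \in um m -> ndrk_ge T m omega1 ->
  exists n, [/\ inM T n, extends m n, ndrk_ge T n omega1 & splits_at n x].
Proof.
move=> Mm xm gew; apply: contrapT => H.
pose P n := [/\ inM T n, extends m n & splits_at n x].
(* Each candidate [n] is assigned a countable ordinal that its rank does not reach; other tuples get
   the default [ord_zero]. *)
have FP n : exists a, P n -> ord_lt a omega1 /\ ~ ndrk_ge T n a.
  have [[Mn mn sp]|] := pselect (P n); last by exists ord_zero.
  have [|a aw nge] := @ndrk_ge_omega1_lt T _ n; last by exists a.
  by move=> gn; apply: H; exists n.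
have [F {}FP] := choice FP.
have [a aw Fa] := @omega1_bounded (mtuple iota) P F (fun n Pn => (FP n Pn).1).
have /ndrk_ge_succP/(_ x xm)[n [Mn _ mn gea sp]] : ndrk_ge T m (ord_succ a).
  by apply: ndrk_ge_ltW gew => //; apply: omega1_limit.2.
(* The witness for rank at least [ord_succ a] is itself a candidate, yet its rank is at least [a],
   which exceeds [F n]. *)
have Pn : P n by [].
by apply: (FP n Pn).2; apply: ndrk_ge_ltW gea => //; apply: Fa.
Qed.

(** The witnesses again have rank at least [omega1], so the successor step can be repeated through
    all ordinals. *)
Lemma ndrk_ge_omega1_all T iota (m : mtuple iota) a : inM T m ->
  ndrk_ge T m omega1 -> ndrk_ge T m a.
Proof.
elim/ord_limit_ind: a m => [|a IH|a la IH] m Mm gew.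
- exact: ndrk_ge_zero.
- apply/ndrk_ge_succP => x xm.
  have [n [Mn mn gen sp]] := ndrk_ge_omega1_splits Mm xm gew.
  exists n; split=> //; last exact: IH.
  by have := splits_at_ell sp; rewrite size_tuple.
- by apply: ndrk_ge_limit => // b ba; apply: IH.
Qed.

Lemma oo_sup_Infty (A : set ONoo) : A Infty -> oo_sup A = Infty.
Proof.
move=> AI; have [|/(_ _ AI)] := @getPex _ [set x | (forall y, A y -> oo_le y x) /\
    forall z, (forall y, A y -> oo_le y z) -> oo_le x z].
  by exists Infty; split=> [[]//|z /(_ _ AI)].
by rewrite -/(oo_sup A); case: (oo_sup A).
Qed.

(** A set with an ordinal upper bound has a least one by well-foundedness, so the [get] in [oo_sup]
    returns a genuine supremum. *)
Lemma oo_sup_le (A : set ONoo) a :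
  (forall y, A y -> oo_le y (Fin a)) -> oo_le (oo_sup A) (Fin a).
Proof.
move=> Aa; have [b Ab minb] :=
  @ord_least (fun b => forall y, A y -> oo_le y (Fin b)) a Aa.
have [|_] := @getPex _ [set x | (forall y, A y -> oo_le y x) /\
    forall z, (forall y, A y -> oo_le y z) -> oo_le x z]; last exact.
by exists (Fin b); split=> // -[c|//] /minb.
Qed.

Lemma NDRK_omega1 T iota : oo_le (Fin omega1) (NDRK T iota) -> NDRK T iota = Infty.
Proof.
move=> gew; have [[m Mm gem]|H] :=
  pselect (exists2 m : mtuple iota, inM T m & ndrk_ge T m omega1).
  apply: oo_sup_Infty; exists m => //.
  suff -> : ndrk T m = Infty by [].
  by apply/(ndrk_Infty Mm) => a; apply: ndrk_ge_omega1_all.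
exfalso.
(* If no rank reaches [omega1], the countably many ranks are bounded by a single [a] below [omega1],
   and then so is their supremum. *)
have FP (m : mtuple iota) : exists a, inM T m -> ord_lt a omega1 /\ ~ ndrk_ge T m a.
  have [Mm|] := pselect (inM T m); last by exists ord_zero.
  have [|a aw nge] := @ndrk_ge_omega1_lt T _ m; last by exists a.
  by move=> gem; apply: H; exists m.
have [F {}FP] := choice FP.
have [a aw Fa] := @omega1_bounded (mtuple iota) (inM T (iota := iota)) F
  (fun m Mm => (FP m Mm).1).
suff : oo_le (NDRK T iota) (Fin a).
  move: gew; case: (NDRK T iota) => //= b wb ba; apply: (@ord_lt_irr a).
  by apply: ord_lt_le_trans aw _; apply: otree_le_trans wb ba.
apply: oo_sup_le => _ [m Mm <-]; have [_ nge] := FP m Mm.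
case E : (ndrk T m) => [c|] /=; last by case: nge; apply/(ndrk_Infty Mm).1.
apply: ord_succ_le; apply: ord_le_lt_trans (Fa m Mm).
have [//|Fc] := ord_lt_or_ge c (F m); first exact: ord_ltW.
by case: nge; apply: ndrk_ge_leW Fc _ => //; case/(ndrk_Fin _ Mm): E.
Qed.

(** * Translations *)

Lemma nth_btadd l (x y : l.-tuple bool) i : i < l ->
  nth false (btadd x y) i = nth false x i (+) nth false y i.
Proof.
by move=> il; rewrite -!(tnth_nth _ _ (Ordinal il)) tnth_mktuple.
Qed.

Lemma take_btadd_btrestr l l' rho (x : l'.-tuple bool) (y : l.-tuple bool) :
    l <= l' -> take l x = y ->
  take l (btadd x (btrestr rho l')) = btadd y (btrestr rho l).
Proof.
move=> ll' xy; apply: (@eq_from_nth _ false).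
  by rewrite size_take_min !size_tuple; apply/minn_idPl.
move=> i; rewrite size_take_min !size_tuple (minn_idPl ll') => il.
have il' : i < l' by apply: leq_trans ll'.
rewrite nth_take // !nth_btadd // -xy nth_take //; congr (_ (+) _).
by rewrite -(tnth_nth _ _ (Ordinal il)) -(tnth_nth _ _ (Ordinal il')) !tnth_mktuple.
Qed.

Lemma inM_translate T iota (m : mtuple iota) r : inM T m -> inM T (translate m r).
Proof.
case=> [[l0 u2] Th dg ug]; have swE (p : offdiag (um (translate m r))) :
    untranslate (offdiag_swap p) = offdiag_swap (untranslate p).
  exact: val_inj.
split=> /=.
- by split=> //; rewrite card_imset //; apply: can_inj (btaddK r).
- by move=> i p; rewrite !ffunE.
- move=> i p; rewrite !ffunE swE; have := dg i (untranslate p).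
  set g := gm m i _; set g' := gm m i _ => E; apply: eq_from_tnth => j.
  have := congr1 (fun t => tnth t j) E; rewrite /= !tnth_mktuple.
  (* Both sides of [E] differ from those of the goal by the same bit of [r]; the identity is checked
     on the five bits at position [j]. *)
  by do 5! case: (tnth _ j).
- move=> p; have := ug (untranslate p); congr (uniq (flatten _)).
  by apply: eq_map => i; rewrite !ffunE swE.
Qed.

Lemma extends_translate iota (m n : mtuple iota) rho : extends m n ->
  extends (translate m (btrestr rho (ell m))) (translate n (btrestr rho (ell n))).
Proof.
move=> mn; have [lmn _ hg] := mn; split=> //.
  apply/extends_umP; split=> /= [_ /imsetP[x xm ->]|_ /imsetP[y yn ->]].
    have [y yn yx] := extends_lift mn xm.
    by exists (btadd y (btrestr rho (ell n))); [apply: imset_f | apply: take_btadd_btrestr].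
  have [x xm yx] := extends_take mn yn.
  by exists (btadd x (btrestr rho (ell m))); [apply: imset_f | apply: take_btadd_btrestr].
by move=> p q p1 p2 i; rewrite !ffunE; apply: hg => /=; apply: take_btadd_btrestr.
Qed.

Lemma translateK iota (m : mtuple iota) r : translate (translate m r) r = m.
Proof.
have tk (x : (ell m).-tuple bool) : take (ell m) x = x.
  by rewrite take_oversize ?size_tuple.
have uE : um (translate (translate m r) r) = um m.
  rewrite /= -imset_comp -[RHS]imset_id; apply: eq_imset => x; exact: btaddK.
(* Antisymmetry replaces an equality of records with dependent fields by statements about
   restrictions, avoiding transport along [uE]. *)
apply: extends_anti; split=> //.
- by apply/extends_umP; split=> x; rewrite uE => xm; exists x; rewrite ?uE //= tk.
- move=> p q; rewrite /= !tk => E1 E2 i; rewrite !ffunE.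
  have -> : untranslate (untranslate q) = p; last by rewrite tk.
  by apply: val_inj; apply: injective_projections; rewrite /= !btaddK; apply: val_inj.
- by apply/extends_umP; split=> x; rewrite uE => xm; exists x; rewrite ?uE //= tk.
- move=> p q; rewrite /= !tk => E1 E2 i; rewrite !ffunE.
  have -> : untranslate (untranslate p) = q; last by rewrite tk.
  by apply: val_inj; apply: injective_projections; rewrite /= !btaddK; apply: val_inj.
Qed.

Lemma splits_at_translate iota (n : mtuple iota) l (x : l.-tuple bool) rho :
  splits_at n x ->
  splits_at (translate n (btrestr rho (ell n))) (btadd x (btrestr rho l)).
Proof.
move=> sp; have := splits_at_ell sp; rewrite size_tuple => ln.
apply: leq_trans sp _.
rewrite -(card_imset _ (can_inj (btaddK (btrestr rho (ell n))))).
apply: subset_leq_card; apply/fintype.subsetP => _ /imsetP[y + ->].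
rewrite !inE /proper_prefix !prefixE !size_tuple => /and3P[yn /eqP yx _].
apply/and3P; split=> //; first exact: imset_f.
by apply/eqP; apply: take_btadd_btrestr yx; apply: ltnW.
Qed.

Lemma ndrk_ge_translate T iota (m : mtuple iota) rho a :
  ndrk_ge T m a -> ndrk_ge T (translate m (btrestr rho (ell m))) a.
Proof.
elim/ord_limit_ind: a m => [|a IH|a la IH] m gea.
- exact: ndrk_ge_zero.
- apply/ndrk_ge_succP => /= _ /imsetP[x xm ->].
  have /ndrk_ge_succP/(_ x xm)[n [Mn ln mn gen sp]] := gea.
  exists (translate n (btrestr rho (ell n))); split=> //.
  + exact: inM_translate.
  + exact: extends_translate.
  + exact: IH.
  + exact: splits_at_translate.
- apply/(ndrk_ge_limitP _ _ la) => b ba; apply: IH => //.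
  exact: (ndrk_ge_limitP _ _ la).1 gea _ ba.
Qed.

(** Translation preserves lower bounds on the rank and is an involution, so it reflects them too. *)
Lemma ndrk_translate T iota (m : mtuple iota) rho :
  ndrk T m = ndrk T (translate m (btrestr rho (ell m))).
Proof.
suff E : ndrk_ge T m = ndrk_ge T (translate m (btrestr rho (ell m))).
  by rewrite /ndrk E.
apply/funext => a; apply/propext; split; first exact: ndrk_ge_translate.
by move/(ndrk_ge_translate rho); rewrite translateK.
Qed.

(** * Restrictions *)

Lemma inM_restrict T iota (m : mtuple iota) (u : {set (ell m).-tuple bool})
    (s : u \subset um m) :
  inM T m -> 2 <= #|u| -> inM T (restrict m s).
Proof.
case=> [[l0 u2] Th dg ug] u'2; have swE (p : offdiag u) :
    offdiag_incl s (offdiag_swap p) = offdiag_swap (offdiag_incl s p).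
  exact: val_inj.
split=> //=.
- by move=> i p; rewrite !ffunE.
- by move=> i p; rewrite !ffunE swE; have := dg i (offdiag_incl s p).
- move=> p; have := ug (offdiag_incl s p); congr (uniq (flatten _)).
  by apply: eq_map => i; rewrite !ffunE swE.
Qed.

Lemma ndrk_ge_restrict T iota (m : mtuple iota) (u : {set (ell m).-tuple bool})
    (s : u \subset um m) a :
  ndrk_ge T m a -> ndrk_ge T (restrict m s) a.
Proof.
elim/ord_limit_ind: a m u s => [|a IH|a la IH] m u s gea.
- exact: ndrk_ge_zero.
- apply/ndrk_ge_succP => /= x xu; have xm := fintype.subsetP s _ xu.
  have /ndrk_ge_succP/(_ x xm)[n [Mn ln mn gen sp]] := gea.
  (* The witness for the restriction is [n] restricted to the nodes above [u]. All extensions of [x]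
     in [um n] survive, so the split at [x] persists and also gives [v] two elements. *)
  pose v := [set y in um n | [exists z in u, take (ell m) y == z]]%SET.
  have sv : v \subset um n by apply/fintype.subsetP => y; rewrite inE => /andP[].
  have splE : [set y in v | proper_prefix x y]%SET =
              [set y in um n | proper_prefix x y]%SET.
    apply/setP => y; rewrite !inE; case: (y \in um n) => //=.
    have [pxy|] := boolP (proper_prefix x y); last by rewrite andbF.
    rewrite andbT; apply/existsP; exists x; rewrite xu /=.
    by case/andP: pxy; rewrite prefixE size_tuple.
  exists (restrict n sv); split=> //.
  + apply: inM_restrict => //; apply: leq_trans sp _.
    by rewrite -splE; apply: subset_leq_card; apply/fintype.subsetP => y; rewrite inE => /andP[].
  + have [lmn _ hg] := mn; split=> //.
      apply/extends_umP; split=> /= [z zu|y].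
        have [y yn yz] := extends_lift mn (fintype.subsetP s _ zu).
        exists y => //; rewrite inE yn; apply/existsP; exists z.
        by rewrite zu yz /=.
      by rewrite inE => /andP[_ /existsP[z /andP[zu /eqP]]]; exists z.
    by move=> p q p1 p2 i; rewrite !ffunE; apply: hg.
  + exact: IH.
  + by rewrite /splits_at /= splE.
- apply/(ndrk_ge_limitP _ _ la) => b ba; apply: IH => //.
  exact: (ndrk_ge_limitP _ _ la).1 gea _ ba.
Qed.

Theorem lemma3p10 (T : nat -> set (seq bool))
    (hT : forall n, is_tree (T n) /\ no_maximal_nodes (T n))
    (iota : nat) (hiota : 2 <= iota) :
  (* (1) *)
  ((forall m : mtuple iota, inM T m -> extends m m) /\
   (forall m n : mtuple iota, inM T m -> inM T n ->
      extends m n -> extends n m -> m = n) /\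
   (forall m n p : mtuple iota, inM T m -> inM T n -> inM T p ->
      extends m n -> extends n p -> extends m p)) /\
  (* (2) *)
  (forall (m n : mtuple iota) (a : ON), inM T m -> inM T n -> extends m n ->
     oo_le (Fin a) (ndrk T n) -> oo_le (Fin a) (ndrk T m)) /\
  (* (3) *)
  ((forall (m : mtuple iota) (a b : ON), inM T m -> ord_lt b a ->
      ndrk_ge T m a -> ndrk_ge T m b) /\
   (forall (m : mtuple iota) (a : ON), inM T m ->
      (oo_le (Fin a) (ndrk T m) <-> ndrk_ge T m a))) /\
  (* (4) *)
  (forall (m : mtuple iota) (rho : nat -> bool), inM T m ->
     inM T (translate m (btrestr rho (ell m))) /\
     ndrk T m = ndrk T (translate m (btrestr rho (ell m)))) /\
  (* (5) *)
  (forall (m : mtuple iota) (nu : (ell m).-tuple bool), inM T m ->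
     nu \in um m -> oo_le (Fin omega1) (ndrk T m) ->
     exists n : mtuple iota,
       [/\ inM T n, extends m n, oo_le (Fin omega1) (ndrk T n) &
           splits_at n nu]) /\
  (* (6) *)
  (forall (m : mtuple iota) (a b : ON), inM T m ->
     ndrk T m = Fin b -> ord_lt a b ->
     exists n : mtuple iota,
       [/\ inM T n, extends m n & ndrk T n = Fin a]) /\
  (* (7) *)
  (oo_le (Fin omega1) (NDRK T iota) -> NDRK T iota = Infty) /\
  (* (8) *)
  (forall (m : mtuple iota) (u' : {set (ell m).-tuple bool})
          (s : u' \subset um m), inM T m -> 2 <= #|u'| ->
     inM T (restrict m s) /\ oo_le (ndrk T m) (ndrk T (restrict m s))).
Proof.
split; first split.
- by move=> m _; apply: extends_refl.
- split=> [m n _ _|m n p _ _ _]; [exact: extends_anti | exact: extends_trans].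
split.
  by move=> m n a Mm Mn mn /(ndrkP _ Mn) gea; apply/(ndrkP _ Mm)/(ndrk_ge_extends mn).
split; first by split=> [m a b Mm|m a Mm]; [exact: ndrk_ge_ltW | exact: ndrkP].
split; first by move=> m rho Mm; split; [exact: inM_translate | exact: ndrk_translate].
split.
  move=> m nu Mm num /(ndrkP _ Mm) gew.
  have [n [Mn mn gen sp]] := ndrk_ge_omega1_splits Mm num gew.
  by exists n; split=> //; apply/ndrkP.
split; first by move=> m a b; apply: ndrk_attains.
split; first exact: NDRK_omega1.
move=> m u' s Mm u2; have Mr := inM_restrict s Mm u2; split=> //.
by apply: oo_leP => a /(ndrkP _ Mm) gea; apply/(ndrkP _ Mr)/ndrk_ge_restrict.
Qed.
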